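(* Let $L_{\alpha_1},\dots,L_{\alpha_n}$ be algebraically independent invertible transcendental elements. Then there is a unique injective algebra homomorphism $$\eta\colon U_{q,q^{-1}}(\mathfrak g)\to U_q(\mathfrak g)\otimes\mathbb K[L_{\alpha_1}^{\pm1},\dots,L_{\alpha_n}^{\pm1}]$$ such that for all $1\le i\le n$ $$e_i\mapsto E_i\otimes L_{\alpha_i},\quad f_i\mapsto F_i\otimes L_{\alpha_i},\quad\omega_i\mapsto K_i\otimes L_{\alpha_i}^2,\quad\omega_i'\mapsto K_i^{-1}\otimes L_{\alpha_i}^2.$$
   Context: $\mathbb K$ is an algebraically closed field, $q\in\mathbb K$ is transcendental (in particular not a root of unity). $\mathfrak g$ is a simple finite-dimensional Lie algebra with simple roots $\alpha_1,\dots,\alpha_n$, form $(\cdot,\cdot)$ normalized so that short roots have square length 2, $a_{ij}=2(\alpha_i,\alpha_j)/(\alpha_i,\alpha_i)$, $q_i=q^{(\alpha_i,\alpha_i)/2}$. $\mathbb K[L_{\alpha_1}^{\pm1},\dots,L_{\alpha_n}^{\pm1}]$ is the Laurent polynomial ring. $U_{q,q^{-1}}(\mathfrak g)$ is the $\mathbb K$-algebra generated by $e_i,f_i,\omega_i^{\pm1},(\omega_i')^{\pm1}$ ($1\le i\le n$) with relations: all $\omega_i,\omega_j'$ commute and are invertible; $\omega_ie_j=q^{(\alpha_i,\alpha_j)}e_j\omega_i$, $\omega_if_j=q^{-(\alpha_i,\alpha_j)}f_j\omega_i$, $\omega_i'e_j=q^{-(\alpha_i,\alpha_j)}e_j\omega_i'$,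 $\omega_i'f_j=q^{(\alpha_i,\alpha_j)}f_j\omega_i'$; $[e_i,f_j]=\delta_{ij}\frac{\omega_i-\omega_i'}{q_i-q_i^{-1}}$; and for $i\neq j$ the usual quantum Serre relations $\sum_{k=0}^{1-a_{ij}}(-1)^k\binom{1-a_{ij}}{k}_{q_i}e_i^{1-a_{ij}-k}e_je_i^k=0$, $\sum_{k=0}^{1-a_{ij}}(-1)^k\binom{1-a_{ij}}{k}_{q_i}f_i^{k}f_jf_i^{1-a_{ij}-k}=0$ (symmetric $q_i$-binomials). $U_q(\mathfrak g)$ is the usual Drinfeld–Jimbo quantum group with generators $E_i,F_i,K_i^{\pm1}$, i.e. the quotient of $U_{q,q^{-1}}(\mathfrak g)$ by $\omega'_i=\omega_i^{-1}$ with $E_i,F_i,K_i$ the images of $e_i,f_i,\omega_i$. *)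

(* Defs.v *)
From HB Require Import structures.
From mathcomp Require Import all_boot all_order all_algebra.
From mathcomp Require Import finmap.
From mathcomp Require Import boolp.
From mathcomp Require classical_sets.
From mathcomp Require Import monalg.

Set Implicit Arguments.
Unset Strict Implicit.
Unset Printing Implicit Defensive.

Import GRing.Theory.

Local Open Scope ring_scope.

(* The library puts a product on {malg K[G]} only when G has no invertible
   element besides the unit, hence this copy for an arbitrary monoid (G, op). *)
Definition monoid_alg (K : comNzRingType) (G : choiceType) (e : G)
  (op : Monoid.law e) : Type := {malg K[G]}.

HB.lock Definition mbasis (K : comNzRingType) (G : choiceType) (e : G)
  (op : Monoid.law e) (g : G) : monoid_alg K op := << g >>.

HB.lock Definition ma_mul (K : comNzRingType) (G : choiceType) (e : G)
  (op : Monoid.law e) (x y : monoid_alg K op) : monoid_alg K op :=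
  \sum_(g <- msupp x) \sum_(h <- msupp y) << x@_g * y@_h *g op g h >>.

Section MonoidAlgebra.

Variables (K : comNzRingType) (G : choiceType) (e : G) (op : Monoid.law e).
Local Notation monoid_alg := (monoid_alg K op).

HB.instance Definition _ := GRing.Lmodule.on monoid_alg.

Implicit Types x y z : monoid_alg.

Local Notation mbasis := (@mbasis K G e op).

Local Notation ma_mul := (@ma_mul K G e op).

Lemma malgU_Z (c : K) (g : G) : << c *g g >> = c *: << g >> :> {malg K[G]}.
Proof.
by apply/malgP=> k; rewrite mcoeffZ !mcoeffU mulrnAr mulr1.
Qed.

Section Extend.
Variables (V : lmodType K) (h : G -> V).

Definition mextend (x : monoid_alg) : V := \sum_(g <- msupp x) x@_g *: h g.

Lemma mextendEw (d : {fset G}) x : (msupp x `<=` d)%fset ->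
  mextend x = \sum_(g <- d) x@_g *: h g.
Proof.
move=> le; rewrite [LHS](big_fset_incl _ le) => //= g _ /mcoeff_outdom ->.
by rewrite scale0r.
Qed.

Lemma mextend_linear : linear mextend.
Proof.
move=> c x y.
pose d := (msupp x `|` msupp y `|` msupp (c *: x + y : monoid_alg))%fset.
rewrite !(mextendEw (d := d)); last 3 first.
- by rewrite /d fsubsetU // fsubsetUr.
- by rewrite /d fsubsetU // fsubsetUl.
- by rewrite /d fsubsetUr.
rewrite scaler_sumr -big_split; apply: eq_bigr => g _ /=.
by rewrite mcoeffD mcoeffZ scalerDl scalerA.
Qed.

HB.instance Definition _ :=
  GRing.isLinear.Build K monoid_alg V *:%R mextend mextend_linear.

Lemma mextendU g : mextend (mbasis g) = h g.
Proof.
rewrite mbasis.unlock (mextendEw (d := [fset g]%fset)).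
  by rewrite big_seq_fset1 mcoeffUU scale1r.
exact: msuppU_le.
Qed.

End Extend.

Lemma mbasisE x : x = \sum_(g <- msupp x) x@_g *: mbasis g.
Proof.
rewrite [LHS]monalgE; apply: eq_bigr => g _.
by rewrite mbasis.unlock; exact: malgU_Z.
Qed.

Lemma eq_mextend (V : lmodType K) (f1 f2 : {linear monoid_alg -> V}) :
  (forall g, f1 (mbasis g) = f2 (mbasis g)) -> f1 =1 f2.
Proof.
move=> E x; rewrite (mbasisE x) !linear_sum; apply: eq_bigr => g _.
by rewrite !linearZ E.
Qed.

Lemma ma_mulE x y :
  ma_mul x y = mextend (fun g => mextend (fun h => mbasis (op g h)) y) x.
Proof.
rewrite ma_mul.unlock; apply: eq_bigr => g _; rewrite scaler_sumr; apply: eq_bigr => h _.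
by rewrite mbasis.unlock malgU_Z scalerA.
Qed.

Lemma ma_mul_linearr x : linear (ma_mul x).
Proof.
move=> c y z; rewrite !ma_mulE /mextend scaler_sumr -big_split /=.
apply: eq_bigr => g _; rewrite -/(mextend _ _) linearP scalerDr !scalerA.
by rewrite mulrC.
Qed.

Lemma ma_mul_linearl y : linear (ma_mul^~ y).
Proof. by move=> c x z; rewrite !ma_mulE linearP. Qed.

HB.instance Definition _ x :=
  GRing.isLinear.Build K monoid_alg monoid_alg *:%R (ma_mul x)
    (ma_mul_linearr x).

Lemma ma_mulUU g h : ma_mul (mbasis g) (mbasis h) = mbasis (op g h).
Proof. by rewrite ma_mulE !mextendU. Qed.

Lemma ma_mulDl : left_distributive ma_mul +%R.
Proof. by move=> x y z; have := ma_mul_linearl z 1 x y; rewrite !scale1r. Qed.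

Lemma ma_mulDr : right_distributive ma_mul +%R.
Proof. by move=> x y z; exact: linearD. Qed.

Lemma ma_mulZl c x y : ma_mul (c *: x) y = c *: ma_mul x y.
Proof.
have := ma_mul_linearl y c x 0; rewrite !addr0 => ->.
have := ma_mul_linearl y 1 0 0; rewrite !scale1r !addr0.
by rewrite -{1}[ma_mul 0 y]addr0 => /addrI <-; rewrite addr0.
Qed.

Lemma ma_mulZr c x y : ma_mul x (c *: y) = c *: ma_mul x y.
Proof. exact: linearZ. Qed.

Lemma ma_mul0l y : ma_mul 0 y = 0.
Proof. by have := ma_mulZl 0 0 y; rewrite !scale0r. Qed.

Lemma ma_ind (P : monoid_alg -> Prop) :
  P 0 -> (forall x y, P x -> P y -> P (x + y)) ->
  (forall c g, P (c *: mbasis g)) -> forall x, P x.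
Proof. by move=> P0 PD PU x; rewrite (mbasisE x); apply: big_ind. Qed.

Lemma ma_mulA : associative ma_mul.
Proof.
move=> x y z; elim/ma_ind: x => [|x1 x2 IH1 IH2|c g].
- by rewrite !ma_mul0l.
- by rewrite !ma_mulDl IH1 IH2.
rewrite !ma_mulZl; congr (_ *: _).
elim/ma_ind: y => [|y1 y2 IH1 IH2|d h].
- by rewrite !(linear0, ma_mul0l).
- by rewrite ma_mulDl !ma_mulDr ma_mulDl IH1 IH2.
rewrite !(ma_mulZl, ma_mulZr); congr (_ *: _).
elim/ma_ind: z => [|z1 z2 IH1 IH2|b k].
- by rewrite !linear0.
- by rewrite !ma_mulDr IH1 IH2.
by rewrite !ma_mulZr !ma_mulUU Monoid.mulmA.
Qed.

Lemma ma_mul1 : left_id (mbasis e) ma_mul.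
Proof.
elim/ma_ind => [|x y IH1 IH2|c g]; first exact: linear0.
- by rewrite ma_mulDr IH1 IH2.
by rewrite ma_mulZr ma_mulUU Monoid.mul1m.
Qed.

Lemma ma_mulr1 : right_id (mbasis e) ma_mul.
Proof.
elim/ma_ind => [|x y IH1 IH2|c g]; first exact: ma_mul0l.
- by rewrite ma_mulDl IH1 IH2.
by rewrite ma_mulZl ma_mulUU Monoid.mulm1.
Qed.

Lemma ma_nz : mbasis e != 0.
Proof. by rewrite mbasis.unlock monalgU_eq0 oner_eq0. Qed.

HB.instance Definition _ := GRing.Zmodule_isNzRing.Build monoid_alg
  ma_mulA ma_mul1 ma_mulr1 ma_mulDl ma_mulDr ma_nz.

HB.instance Definition _ := GRing.Lmodule_isLalgebra.Build K monoid_alg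
  (fun c x y => esym (ma_mulZl c x y)).

HB.instance Definition _ := GRing.Lalgebra_isAlgebra.Build K monoid_alg
  (fun c x y => esym (ma_mulZr c x y)).

Lemma mbasis1 : mbasis e = 1. Proof. by []. Qed.

Lemma mbasisM g h : mbasis (op g h) = mbasis g * mbasis h.
Proof. by rewrite -ma_mulUU. Qed.

Section Lift.
Variables (A : algType K) (h : G -> A).

Lemma mextend_monoid : h e = 1 -> {morph h : a b / op a b >-> a * b} ->
  monoid_morphism (mextend h).
Proof.
move=> h1 hM; split=> [|x y]; first by rewrite -mbasis1 mextendU.
elim/ma_ind: x => [|x1 x2 IH1 IH2|c g].
- by rewrite mul0r linear0 mul0r.
- by rewrite mulrDl !linearD /= mulrDl IH1 IH2.
rewrite -scalerAl !linearZ /= -scalerAl; congr (_ *: _).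
elim/ma_ind: y => [|y1 y2 IH1 IH2|d k].
- by rewrite mulr0 linear0 mulr0.
- by rewrite mulrDr !linearD /= mulrDr IH1 IH2.
by rewrite -scalerAr !linearZ /= -scalerAr -mbasisM !mextendU hM.
Qed.

End Lift.

End MonoidAlgebra.

Arguments mbasis {K G e op} g.

Section AlgebraQuotient.

Variables (K : comNzRingType) (A : algType K) (R : A -> A -> Prop).

Definition two_sided_ideal (I : A -> Prop) : Prop :=
  [/\ I 0, forall x y, I x -> I y -> I (x + y)
    & forall a x b, I x -> I (a * x * b)].

Definition in_ideal (x : A) : Prop :=
  forall I : A -> Prop, two_sided_ideal I ->
  (forall a b, R a b -> I (a - b)) -> I x.

Lemma in_ideal_two_sided : two_sided_ideal in_ideal.
Proof.
split=> [I []|x y Ix Iy I tI RI|a x b Ix I tI RI] //; case: (tI) => _ ID IM.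
  by apply: ID; [apply: Ix | apply: Iy].
by apply: IM; apply: Ix.
Qed.

Lemma in_idealN x : in_ideal x -> in_ideal (- x).
Proof.
case: in_ideal_two_sided => _ _ IM /(IM (-1) _ 1).
by rewrite mulr1 mulN1r.
Qed.

Lemma in_ideal_rel a b : R a b -> in_ideal (a - b).
Proof. by move=> Rab I _; apply. Qed.

Definition ideal_pred : {pred A} := fun x => `[< in_ideal x >].

Lemma ideal_predE x : (x \in ideal_pred) = `[< in_ideal x >].
Proof. by []. Qed.

Lemma ideal_zmod_closed : zmod_closed ideal_pred.
Proof.
case: in_ideal_two_sided => I0 ID _.
split=> [|x y]; first exact/asboolP.
move=> /asboolP Ix /asboolP Iy; apply/asboolP.
exact: (ID _ _ Ix (in_idealN Iy)).
Qed.

HB.instance Definition _ :=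
  GRing.isZmodClosed.Build A ideal_pred ideal_zmod_closed.

Lemma idealMl a x : x \in ideal_pred -> a * x \in ideal_pred.
Proof.
case: in_ideal_two_sided => _ _ IM /asboolP /(IM a _ 1).
by rewrite mulr1 => /asboolP.
Qed.

Lemma idealMr a x : x \in ideal_pred -> x * a \in ideal_pred.
Proof.
case: in_ideal_two_sided => _ _ IM /asboolP /(IM 1 _ a).
by rewrite mul1r => /asboolP.
Qed.

(* MathComp rings are nontrivial, so the type of the quotient by the two-sided
   ideal generated by the a - b with R a b carries a proof that it is proper. *)
Definition alg_quot (nz : ~ in_ideal 1) : Type := Quotient.quot ideal_pred.

Section Structure.

Variable nz : ~ in_ideal 1.
Local Notation Q := (alg_quot nz).

HB.instance Definition _ := GRing.Zmodule.on Q.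

Definition qpi (x : A) : Q := \pi_(Quotient.quot ideal_pred)%qT x.
Definition qrepr (x : Q) : A := repr (x : Quotient.quot ideal_pred).

Lemma qreprK : cancel qrepr qpi.
Proof. by move=> x; exact: reprK. Qed.

Lemma qpi_eqP x y : reflect (qpi x = qpi y) (x - y \in ideal_pred).
Proof. by rewrite Quotient.idealrBE; exact: eqP. Qed.

Lemma qpi_rel a b : R a b -> qpi a = qpi b.
Proof. by move=> Rab; apply/qpi_eqP/asboolP; exact: in_ideal_rel. Qed.

Lemma qpi_zmod : zmod_morphism qpi.
Proof. by move=> x y; rewrite /qpi raddfB. Qed.

HB.instance Definition _ := GRing.isZmodMorphism.Build A Q qpi qpi_zmod.

Definition qmul (x y : Q) : Q := qpi (qrepr x * qrepr y).
Definition qscale (c : K) (x : Q) : Q := qpi (c *: qrepr x).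

Lemma qpi_reprB x : qrepr (qpi x) - x \in ideal_pred.
Proof. by apply/qpi_eqP; rewrite qreprK. Qed.

Lemma qpi_mulE x y : qmul (qpi x) (qpi y) = qpi (x * y).
Proof.
apply/qpi_eqP; set x' := qrepr _; set y' := qrepr _.
rewrite -[x' * y'](subrK (x * y')) -mulrBl -addrA -mulrBr.
by apply: rpredD; [apply: idealMr | apply: idealMl]; exact: qpi_reprB.
Qed.

Lemma qpi_scaleE c x : qscale c (qpi x) = qpi (c *: x).
Proof.
apply/qpi_eqP; rewrite -scalerBr -mulr_algl; apply: idealMl; exact: qpi_reprB.
Qed.

Lemma qmulA : associative qmul.
Proof.
move=> x y z; rewrite -[x]qreprK -[y]qreprK -[z]qreprK.
by rewrite !qpi_mulE mulrA.
Qed.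

Lemma qmul1 : left_id (qpi 1) qmul.
Proof. by move=> x; rewrite -[x]qreprK qpi_mulE mul1r. Qed.

Lemma qmulr1 : right_id (qpi 1) qmul.
Proof. by move=> x; rewrite -[x]qreprK qpi_mulE mulr1. Qed.

Lemma qmulDl : left_distributive qmul +%R.
Proof.
move=> x y z; rewrite -[x]qreprK -[y]qreprK -[z]qreprK.
by rewrite -raddfD !qpi_mulE -raddfD mulrDl.
Qed.

Lemma qmulDr : right_distributive qmul +%R.
Proof.
move=> x y z; rewrite -[x]qreprK -[y]qreprK -[z]qreprK.
by rewrite -raddfD !qpi_mulE -raddfD mulrDr.
Qed.

Lemma q1_neq0 : qpi 1 != 0.
Proof.
apply/eqP; rewrite -(raddf0 qpi) => /qpi_eqP.
by rewrite subr0 => /asboolP /nz.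
Qed.

HB.instance Definition _ := GRing.Zmodule_isNzRing.Build Q
  qmulA qmul1 qmulr1 qmulDl qmulDr q1_neq0.

Lemma qscaleA a b x : qscale a (qscale b x) = qscale (a * b) x.
Proof. by rewrite -[x]qreprK !qpi_scaleE scalerA. Qed.

Lemma qscale1 : left_id 1 qscale.
Proof. by move=> x; rewrite -[x]qreprK qpi_scaleE scale1r. Qed.

Lemma qscaleDr : right_distributive qscale +%R.
Proof.
move=> a x y; rewrite -[x]qreprK -[y]qreprK.
by rewrite -raddfD !qpi_scaleE -raddfD scalerDr.
Qed.

Lemma qscaleDl x : {morph qscale^~ x : a b / a + b}.
Proof. by move=> a b; rewrite -[x]qreprK !qpi_scaleE -raddfD scalerDl. Qed.

HB.instance Definition _ := GRing.Zmodule_isLmodule.Build K Q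
  qscaleA qscale1 qscaleDr qscaleDl.

Lemma qpi_monoid : monoid_morphism qpi.
Proof. by split=> // x y; rewrite -qpi_mulE. Qed.

HB.instance Definition _ := GRing.isMonoidMorphism.Build A Q qpi qpi_monoid.

Lemma qpi_scalable : scalable qpi.
Proof. by move=> c x; rewrite -qpi_scaleE. Qed.

HB.instance Definition _ :=
  GRing.isScalable.Build K A Q *:%R qpi qpi_scalable.

Lemma qpiZ c x : c *: qpi x = qpi (c *: x).
Proof. exact: qpi_scaleE. Qed.

Lemma qscaleAl (c : K) (x y : Q) : c *: (x * y) = (c *: x) * y.
Proof.
rewrite -[x]qreprK -[y]qreprK.
by rewrite -rmorphM !qpiZ -rmorphM scalerAl.
Qed.

HB.instance Definition _ := GRing.Lmodule_isLalgebra.Build K Q qscaleAl.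

Lemma qscaleAr (c : K) (x y : Q) : c *: (x * y) = x * (c *: y).
Proof.
rewrite -[x]qreprK -[y]qreprK.
by rewrite -rmorphM !qpiZ -rmorphM scalerAr.
Qed.

HB.instance Definition _ := GRing.Lalgebra_isAlgebra.Build K Q qscaleAr.

Section QLift.

Definition qlift (B : algType K) (f : {lrmorphism A -> B})
  (fR : forall a b, R a b -> f a = f b) (x : Q) : B := f (qrepr x).

Variables (B : algType K) (f : {lrmorphism A -> B}).
Hypothesis fR : forall a b, R a b -> f a = f b.
Local Notation lift := (qlift fR).

Lemma ideal_ker x : in_ideal x -> f x = 0.
Proof.
move/(_ (fun y => f y = 0)); apply=> [|a b /fR fab]; last by rewrite rmorphB /= fab subrr.
split=> [|u v fu fv|a u b fu]; first exact: rmorph0.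
  by rewrite rmorphD /= fu fv addr0.
by rewrite !rmorphM /= fu mulr0 mul0r.
Qed.

Lemma qliftE x : lift (qpi x) = f x.
Proof.
apply/eqP; rewrite -subr_eq0 -rmorphB; apply/eqP/ideal_ker.
by apply/asboolP; exact: qpi_reprB.
Qed.

Lemma qlift_zmod : zmod_morphism lift.
Proof.
move=> x y; rewrite -[x]qreprK -[y]qreprK -rmorphB !qliftE.
exact: rmorphB.
Qed.

Lemma qlift_monoid : monoid_morphism lift.
Proof.
split=> [|x y]; first by rewrite -(rmorph1 qpi) qliftE rmorph1.
rewrite -[x]qreprK -[y]qreprK -rmorphM !qliftE.
exact: rmorphM.
Qed.

Lemma qlift_scalable : scalable lift.
Proof. by move=> c x; rewrite -[x]qreprK -linearZ !qliftE linearZ. Qed.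

HB.instance Definition _ := GRing.isZmodMorphism.Build Q B lift qlift_zmod.
HB.instance Definition _ :=
  GRing.isMonoidMorphism.Build Q B lift qlift_monoid.
HB.instance Definition _ :=
  GRing.isScalable.Build K Q B *:%R lift qlift_scalable.

End QLift.

End Structure.

Lemma proper_ideal (B : algType K) (f : {lrmorphism A -> B}) :
  (forall a b, R a b -> f a = f b) -> ~ in_ideal 1.
Proof.
move=> fR /(ideal_ker fR) /eqP; by rewrite rmorph1 oner_eq0.
Qed.

End AlgebraQuotient.

Arguments qpi {K A R nz}.
Arguments qlift {K A R nz B f} fR x.

Section TensorProduct.

Variable K : fieldType.

Lemma unit_functional (A : algType K) :
  exists phi : A -> K, [/\ scalar phi & phi 1 = 1].
Proof.
pose P (M : A -> Prop) :=
  (forall c x y, M x -> M y -> M (c *: x + y)) /\ ~ M 1.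
have [F FP Ftot|M [[Ml M1] Mmax]] := @classical_sets.Zorn_bigcup A P.
  split=> [c x y [X FX Xx] [Y FY Yy]|[X FX X1]].
    have [XY|YX] := Ftot _ _ FX FY.
      by exists Y => //; have [Yl _] := FP _ FY; apply: Yl => //; apply: XY.
    by exists X => //; have [Xl _] := FP _ FX; apply: Xl => //; apply: YX.
  by have [_] := FP _ FX; apply.
have M0 : M 0.
  apply: contrapT => M0; have noM x : ~ M x.
    by move=> Mx; apply: M0; rewrite -(subrr x) addrC -scaleN1r; apply: Ml.
  apply: (Mmax (fun x => x = 0)).
    by split=> [x /noM|] //; move=> /(_ 0 erefl).
  split=> [c x y -> ->|/eqP]; first by rewrite scaler0 addr0.
  by rewrite oner_eq0.
have MZ c x : M x -> M (c *: x) by move=> Mx; rewrite -[_ *: _]addr0; apply: Ml.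
have MD x y : M x -> M y -> M (x + y).
  by move=> Mx My; rewrite -[x]scale1r; apply: Ml.
have ex a : exists c, M (a - c *: 1).
  have [Ma|Ma] := pselect (M a); first by exists 0; rewrite scale0r subr0.
  pose N x := exists m c, M m /\ x = m + c *: a.
  have [m [c [Mm E1]]] : N 1.
    apply: contrapT => N1; apply: (Mmax N); last first.
      split=> // c x y [m [d [Mm ->]]] [m' [d' [Mm' ->]]].
      exists (c *: m + m'), (c * d + d'); split; first exact: Ml.
      by rewrite scalerDr addrACA scalerA scalerDl.
    split=> [x Mx|NM]; first by exists x, 0; rewrite scale0r addr0.
    by apply: Ma; apply: NM; exists 0, 1; rewrite add0r scale1r.
  have c0 : c != 0.
    by apply: contra_notN M1 => /eqP c0; rewrite E1 c0 scale0r addr0.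
  exists c^-1; rewrite E1 scalerDr scalerA mulVf // scale1r opprD addrCA.
  by rewrite subrr addr0 -scaleNr; apply: MZ.
have uniq c d a : M (a - c *: 1) -> M (a - d *: 1) -> c = d.
  move=> Mc Md; apply/eqP; rewrite -subr_eq0; apply: contra_notT M1 => cd.
  have : M ((c - d) *: 1).
    suff -> : (c - d) *: 1 = -1 *: (a - c *: 1) + (a - d *: 1) :> A.
      exact: Ml.
    by rewrite scaleN1r opprB scalerBl addrA subrK.
  by move=> /(MZ (c - d)^-1); rewrite scalerA mulVf // scale1r.
have [phi Mphi] := choice ex.
exists phi; split=> [c x y|].
  apply: (uniq _ _ (c *: x + y)) => //.
  rewrite scalerDl -scalerA opprD addrACA -scalerBr.
  exact: Ml.
by apply: (uniq _ _ 1) => //; rewrite scale1r subrr.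
Qed.

Variables A B : algType K.

(* The free module on A x B, which is the monoid algebra of the multiplicative
   monoid A x B, modulo the bilinearity relations; their span is already a
   two-sided ideal, and (a (x) b) (a' (x) b') = aa' (x) bb'. *)
Definition pair_alg : Type := @monoid_alg K (A * B)%type 1 *%R.

HB.instance Definition _ := GRing.Algebra.on pair_alg.

Definition pairing (a : A) (b : B) : pair_alg := mbasis (a, b).

Inductive bilinearity : pair_alg -> pair_alg -> Prop :=
| Bilin_Dl a a' b : bilinearity (pairing (a + a') b) (pairing a b + pairing a' b)
| Bilin_Dr a b b' : bilinearity (pairing a (b + b')) (pairing a b + pairing a b')
| Bilin_Zl c a b : bilinearity (pairing (c *: a) b) (c *: pairing a b)
| Bilin_Zr c a b : bilinearity (pairing a (c *: b)) (c *: pairing a b).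

Lemma bilinearity_proper : ~ in_ideal bilinearity 1.
Proof.
have [phi [phil phi1]] := unit_functional A.
have [psi [psil psi1]] := unit_functional B.
pose f (u : A * B) : K^o := phi u.1 * psi u.2.
pose Phi : {linear pair_alg -> K^o} := mextend f.
have phiD x y : phi (x + y) = phi x + phi y.
  by have := phil 1 x y; rewrite scale1r mul1r.
have psiD x y : psi (x + y) = psi x + psi y.
  by have := psil 1 x y; rewrite scale1r mul1r.
have phi0 : phi 0 = 0 by apply: (addrI (phi 0)); rewrite -phiD !addr0.
have psi0 : psi 0 = 0 by apply: (addrI (psi 0)); rewrite -psiD !addr0.
have phiZ c x : phi (c *: x) = c * phi x.
  by have := phil c x 0; rewrite addr0 phi0 addr0.
have psiZ c x : psi (c *: x) = c * psi x.
  by have := psil c x 0; rewrite addr0 psi0 addr0.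
have PhiE a b : Phi (pairing a b) = phi a * psi b by exact: mextendU.
have pM a b a' b' : pairing a b * pairing a' b' = pairing (a * a') (b * b').
  by rewrite -mbasisM.
pose I x := forall u v, Phi (u * x * v) = 0.
move=> /(_ I) I1; suff /(_ 1 1) : I 1.
  by rewrite !mulr1 -mbasis1 PhiE phi1 psi1 mulr1 => /eqP; rewrite oner_eq0.
apply: I1 => [|s t st u v].
  split=> [u v|x y Ix Iy u v|a x b Ix u v].
  - by rewrite mulr0 mul0r linear0.
  - by rewrite mulrDr mulrDl linearD /= Ix Iy addr0.
  by rewrite -!mulrA (mulrA u) mulrA Ix.
elim/ma_ind: u => [|u1 u2 IH1 IH2|c [a0 b0]].
- by rewrite !mul0r linear0.
- by rewrite !mulrDl linearD /= IH1 IH2 addr0.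
rewrite -!scalerAl linearZ; apply/eqP; rewrite scaler_eq0; apply/orP; right.
apply/eqP; elim/ma_ind: v => [|v1 v2 IH1 IH2|d [a1 b1]].
- by rewrite mulr0 linear0.
- by rewrite mulrDr linearD /= IH1 IH2 addr0.
rewrite -scalerAr linearZ; apply/eqP; rewrite scaler_eq0; apply/orP; right.
apply/eqP; rewrite -/(pairing a0 b0) -/(pairing a1 b1).
rewrite mulrBr mulrBl linearB; apply/eqP; rewrite subr_eq0; apply/eqP.
case: st => [a a' b|a b b'|k a b|k a b].
- rewrite mulrDr mulrDl linearD /= !pM !PhiE mulrDr mulrDl phiD.
  by rewrite mulrDl.
- rewrite mulrDr mulrDl linearD /= !pM !PhiE mulrDr mulrDl psiD.
  by rewrite mulrDr.
- rewrite -scalerAr -scalerAl linearZ /= !pM !PhiE -scalerAr -scalerAl phiZ.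
  exact/esym/mulrA.
rewrite -scalerAr -scalerAl linearZ /= !pM !PhiE -scalerAr -scalerAl psiZ.
exact: mulrCA.
Qed.

Definition tensor : Type := alg_quot bilinearity_proper.

HB.instance Definition _ := GRing.Algebra.on tensor.

Definition tens (a : A) (b : B) : tensor := qpi (pairing a b).

End TensorProduct.

Notation "a ⊗ b" := (tens a b) (at level 40, left associativity) : ring_scope.

HB.mixin Record Vector_isLie (F : fieldType) g of Vector F g := {
  lie : g -> g -> g;
  lie_linear_l : forall y, linear (lie^~ y);
  lie_linear_r : forall x, linear (lie x);
  lie_alternating : forall x, lie x x = 0;
  lie_jacobi : forall x y z,
    lie x (lie y z) + lie y (lie z x) + lie z (lie x y) = 0
}.

#[short(type="lieAlgType")]
HB.structure Definition LieAlgebra (F : fieldType) :=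
  {g of Vector F g & Vector_isLie F g}.

Section LieAlgebra.

Variables (F : fieldType) (g : lieAlgType F).

HB.instance Definition _ (x : g) :=
  GRing.isLinear.Build F g g *:%R (lie x) (lie_linear_r x).

Definition ad (x : g) : 'End(g) := linfun (lie x).

Definition lie_simple : Prop :=
  (exists x y : g, lie x y != 0) /\
  forall I : {vspace g}, (forall x y, y \in I -> lie x y \in I) ->
    I = 0%VS \/ I = fullv.

Definition killing (x y : g) : F :=
  let e := vbasis {:g} in \tr (passmx.mxof e e (ad x \o ad y)%VF).

(* a nilpotent self-normalizing subalgebra *)
Definition cartan_subalgebra (h : {vspace g}) : Prop :=
  [/\ forall x y, x \in h -> y \in h -> lie x y \in h,
      exists m, forall (s : seq g) y, size s = m ->
        {subset s <= h} -> y \in h -> foldr (@lie F g) y s = 0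
    & forall x, (forall y, y \in h -> lie x y \in h) -> x \in h].

Variable h : {vspace g}.

Local Notation dual := 'Hom(subvs_of h, F^o).

Definition is_root (beta : dual) : Prop :=
  beta != 0 /\
  exists2 x : g, x != 0 & forall t : subvs_of h, lie (vsval t) x = (beta t : F) *: x.

Definition simple_roots (n : nat) (alpha : 'I_n -> dual) : Prop :=
  [/\ basis_of fullv (codom alpha), forall i, is_root (alpha i)
    & forall beta, is_root beta -> exists m : 'I_n -> nat,
        beta = \sum_i alpha i *+ m i \/ beta = - \sum_i alpha i *+ m i].

(* The form on the dual of h induced by the Killing form (nu beta is the element
   of h representing beta), rescaled so that the short roots, i.e. the roots of
   minimal square length, have square length 2. *)
Definition normalized_form (form : dual -> dual -> F) : Prop :=
  [/\ exists (c : F) (nu : dual -> subvs_of h), [/\ c != 0,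
        forall beta t, killing (vsval (nu beta)) (vsval t) = beta t
      & forall beta gamma,
          form beta gamma = c * killing (vsval (nu beta)) (vsval (nu gamma))],
      exists2 beta, is_root beta & form beta beta = 2%:R
    & forall beta, is_root beta ->
        exists2 m : nat, (2 <= m)%N & form beta beta = m%:R].

End LieAlgebra.

Definition transcendental (K : fieldType) (q : K) : Prop :=
  forall p : {poly int},
    map_poly intr p != 0 :> {poly K} -> ~~ root (map_poly intr p) q.

Section Laurent.

Variables (K : comNzRingType) (n : nat).

(* the group algebra of Z^n: the Laurent monomials are a basis *)
Definition laurent : Type := @monoid_alg K {ffun 'I_n -> int} 0 +%R.

HB.instance Definition _ := GRing.Algebra.on laurent.

Definition laurent_var (i : 'I_n) : laurent :=
  mbasis [ffun j => (j == i)%:Z].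

End Laurent.

Inductive qgen (n : nat) : Type :=
  | Ge of 'I_n | Gf of 'I_n
  | Gw of 'I_n | Gwinv of 'I_n | Gw' of 'I_n | Gw'inv of 'I_n.

Section QGenChoice.

Variable n : nat.

Definition qgen_code (x : qgen n) : 'I_6 * 'I_n :=
  match x with
  | Ge i => (inord 0, i) | Gf i => (inord 1, i)
  | Gw i => (inord 2, i) | Gwinv i => (inord 3, i)
  | Gw' i => (inord 4, i) | Gw'inv i => (inord 5, i)
  end.

Definition qgen_decode (p : 'I_6 * 'I_n) : qgen n :=
  match val p.1 with
  | 0%N => Ge p.2 | 1%N => Gf p.2
  | 2%N => Gw p.2 | 3%N => Gwinv p.2
  | 4%N => Gw' p.2 | _ => Gw'inv p.2
  end.

Lemma qgen_codeK : cancel qgen_code qgen_decode.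
Proof. by case=> i; rewrite /qgen_decode /= inordK. Qed.

HB.instance Definition _ := Choice.copy (qgen n) (can_type qgen_codeK).

End QGenChoice.

Section QuantumNumbers.

Variables (K : fieldType) (v : K).

Definition qint (m : nat) : K := (v ^ m%:Z - v ^ (- m%:Z)) / (v - v^-1).
Definition qfact (m : nat) : K := \prod_(1 <= s < m.+1) qint s.
Definition qbinom (m k : nat) : K := qfact m / (qfact k * qfact (m - k)).

End QuantumNumbers.

(* U_{q,q^-1}(g) and U_q(g); they depend on g only through the matrix b of the
   inner products (alpha_i, alpha_j). *)
Section QuantumGroups.

Variables (K : fieldType) (q : K) (n : nat) (b : 'M[int]_n).

(* Both divisions are exact when b comes from a simple Lie algebra. *)
Definition cartan_entry (i j : 'I_n) : int := (2 * b i j %/ b i i)%Z.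
Definition q_ (i : 'I_n) : K := q ^ (b i i %/ 2)%Z.

Definition serre_deg (i j : 'I_n) : nat := `|1 - cartan_entry i j|%N.

Definition free_alg : Type := @monoid_alg K (seq (qgen n)) [::] cat.

HB.instance Definition _ := GRing.Algebra.on free_alg.

Definition gen (x : qgen n) : free_alg := mbasis [:: x].

Local Notation e i := (gen (Ge i)).
Local Notation f i := (gen (Gf i)).
Local Notation w i := (gen (Gw i)).
Local Notation winv i := (gen (Gwinv i)).
Local Notation w' i := (gen (Gw' i)).
Local Notation w'inv i := (gen (Gw'inv i)).

Inductive Uqq_rel : free_alg -> free_alg -> Prop :=
| Rel_wwinv i : Uqq_rel (w i * winv i) 1
| Rel_winvw i : Uqq_rel (winv i * w i) 1
| Rel_w'w'inv i : Uqq_rel (w' i * w'inv i) 1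
| Rel_w'invw' i : Uqq_rel (w'inv i * w' i) 1
| Rel_ww i j : Uqq_rel (w i * w j) (w j * w i)
| Rel_ww' i j : Uqq_rel (w i * w' j) (w' j * w i)
| Rel_w'w' i j : Uqq_rel (w' i * w' j) (w' j * w' i)
| Rel_we i j : Uqq_rel (w i * e j) (q ^ b i j *: (e j * w i))
| Rel_wf i j : Uqq_rel (w i * f j) (q ^ (- b i j) *: (f j * w i))
| Rel_w'e i j : Uqq_rel (w' i * e j) (q ^ (- b i j) *: (e j * w' i))
| Rel_w'f i j : Uqq_rel (w' i * f j) (q ^ b i j *: (f j * w' i))
| Rel_ef i : Uqq_rel (e i * f i - f i * e i)
                     ((q_ i - (q_ i)^-1)^-1 *: (w i - w' i))
| Rel_ef0 i j : i != j -> Uqq_rel (e i * f j - f j * e i) 0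
| Rel_serre_e i j : i != j ->
    let N := serre_deg i j in
    Uqq_rel
      (\sum_(k < N.+1) ((-1) ^+ k * qbinom (q_ i) N k)
                         *: (e i ^+ (N - k) * e j * e i ^+ k)) 0
| Rel_serre_f i j : i != j ->
    let N := serre_deg i j in
    Uqq_rel
      (\sum_(k < N.+1) ((-1) ^+ k * qbinom (q_ i) N k)
                         *: (f i ^+ k * f j * f i ^+ (N - k))) 0.

(* The counit shows that the relations generate a proper ideal. *)
Definition counit_gen (x : qgen n) : K^o :=
  match x with Ge _ | Gf _ => 0 | _ => 1 end.

Definition counit : free_alg -> K^o :=
  mextend (fun s : seq (qgen n) => \prod_(x <- s) counit_gen x).

HB.instance Definition _ := GRing.Linear.on counit.

Lemma counit_monoid : monoid_morphism counit.
Proof.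
apply: mextend_monoid => [|s t]; [exact: big_nil | exact: big_cat].
Qed.

HB.instance Definition _ :=
  GRing.isMonoidMorphism.Build free_alg K^o counit counit_monoid.

Lemma counitE x : counit (gen x) = counit_gen x.
Proof. by rewrite /counit mextendU big_seq1. Qed.

Lemma counit_rel x y : Uqq_rel x y -> counit x = counit y.
Proof.
have M u v : counit (u * v) = counit u * counit v by exact: rmorphM.
have Z c u : counit (c *: u) = c * counit u by exact: linearZ.
have B u v : counit (u - v) = counit u - counit v by exact: raddfB.
have E0 : counit 0 = 0 by exact: raddf0.
have E1 : counit 1 = 1 by exact: rmorph1.
have S (m : nat) (F : 'I_m -> free_alg) :
  counit (\sum_(k < m) F k) = \sum_(k < m) counit (F k) by exact: raddf_sum.
have S0 (m : nat) (c : 'I_m -> K) (F G : 'I_m -> free_alg) z :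
    counit z = 0 -> counit (\sum_(k < m) c k *: (F k * z * G k)) = counit 0.
  move=> z0; rewrite S E0; apply: big1 => k _.
  by rewrite Z !M z0 mulr0 mul0r mulr0.
case=> [i|i|i|i|i j|i j|i j|i j|i j|i j|i j|i|i j _|i j _ N|i j _ N].
1-4: by rewrite M !counitE E1 mulr1.
1-3: by rewrite !M !counitE.
1-4: by rewrite Z !M !counitE /= mulr0 mul0r mulr0.
- by rewrite B Z B !M !counitE /= mulr0 !subrr mulr0.
- by rewrite B !M !counitE /= E0 mulr0 subrr.
- by apply: S0; rewrite counitE.
- by apply: S0; rewrite counitE.
Qed.

Definition Uqq : Type := alg_quot (proper_ideal counit_rel).

HB.instance Definition _ := GRing.Algebra.on Uqq.

Definition Uqq_gen (x : qgen n) : Uqq := qpi (gen x).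

Inductive Uq_rel : Uqq -> Uqq -> Prop :=
| Rel_w'_winv i : Uq_rel (Uqq_gen (Gw' i)) (Uqq_gen (Gwinv i)).

Definition counit_Uqq : {lrmorphism Uqq -> K^o} := qlift counit_rel.

Lemma counit_Uq_rel x y : Uq_rel x y -> counit_Uqq x = counit_Uqq y.
Proof. by case=> i; rewrite [LHS]qliftE [RHS]qliftE [LHS]counitE [RHS]counitE. Qed.

Definition Uq : Type := alg_quot (proper_ideal counit_Uq_rel).

HB.instance Definition _ := GRing.Algebra.on Uq.

Definition Uq_gen (x : qgen n) : Uq := qpi (Uqq_gen x).

Definition eta_on_generators (eta : Uqq -> tensor Uq (laurent K n)) : Prop :=
  forall i : 'I_n, let L := laurent_var K i in
  [/\ eta (Uqq_gen (Ge i)) = Uq_gen (Ge i) ⊗ L,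
      eta (Uqq_gen (Gf i)) = Uq_gen (Gf i) ⊗ L,
      eta (Uqq_gen (Gw i)) = Uq_gen (Gw i) ⊗ (L ^+ 2)
    & eta (Uqq_gen (Gw' i)) = Uq_gen (Gwinv i) ⊗ (L ^+ 2)].

End QuantumGroups.

(* Main.v *)
(* Each z_i = w_i w'_i is central in U = U_{q,q^-1}(g). Adjoin to U commuting
   fourth roots L_i of the z_i, i.e. form U' = (U ⊗ K[L]) / (z_i ⊗ 1 - 1 ⊗ L_i^4).
   The map u ⊗ L^d |-> u z^(d/4), or 0 if 4 does not divide d, kills the ideal,
   so U embeds in U'. In U' the elements e_i L_i^-1, f_i L_i^-1, w_i L_i^-2 and
   w'_i L_i^-2 satisfy the relations of U_q(g), because
   (w_i L_i^-2) (w'_i L_i^-2) = 1. This gives an algebra map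
   U_q(g) ⊗ K[L] -> U' whose composite with eta is the embedding of U, so eta is
   injective. *)
From HB Require Import structures.
Require Import Defs.
From mathcomp Require Import all_boot all_order all_algebra.
From mathcomp Require Import boolp.

Set Implicit Arguments.
Unset Strict Implicit.
Unset Printing Implicit Defensive.

Import GRing.Theory.
Local Open Scope ring_scope.

(** * Linear maps out of a quotient algebra *)

Section QuotientLinearLift.

Variables (K : comNzRingType) (A : algType K) (R : A -> A -> Prop).
Variables (V : lmodType K) (f : {linear A -> V}).
Hypothesis f_rel : forall x y a b, R a b -> f (x * a * y) = f (x * b * y).

(** The elements [x] such that [f] kills every [a * x * b] form a two-sided ideal inside the kernel,
    and [f_rel] puts the relations into it. Linearity of [f] suffices, so this covers projections
    that are not multiplicative. *)
Lemma linear_ideal_ker x : in_ideal R x -> f x = 0.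
Proof.
pose I x := forall a b, f (a * x * b) = 0.
move=> /(_ I) Ix; suff /(_ 1 1) : I x by rewrite mul1r mulr1.
apply: Ix => [|a b Rab u v]; last first.
  by rewrite mulrBr mulrBl linearB /= (f_rel u v Rab) subrr.
split=> [u v|a b Ia Ib u v|a y b Iy u v].
- by rewrite mulr0 mul0r linear0.
- by rewrite mulrDr mulrDl linearD /= Ia Ib addr0.
by rewrite -!mulrA (mulrA u) mulrA Iy.
Qed.

Variable nz : ~ in_ideal R 1.

Definition qlinlift (x : alg_quot nz) : V := f (qrepr x).

Lemma qlinliftE x : qlinlift (qpi x) = f x.
Proof.
apply/eqP; rewrite -subr_eq0 -linearB; apply/eqP/linear_ideal_ker.
by apply/asboolP; exact: qpi_reprB.
Qed.

Lemma qlinlift_linear : linear qlinlift.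
Proof.
move=> c x y; rewrite -[x]qreprK -[y]qreprK -linearP !qlinliftE.
exact: linearP.
Qed.

HB.instance Definition _ :=
  GRing.isLinear.Build K (alg_quot nz) V *:%R qlinlift qlinlift_linear.

End QuotientLinearLift.

(** * Universal property of the tensor product of algebras *)

Section TensorTheory.

Variables (K : fieldType) (A B : algType K).

Lemma tensDl (a a' : A) (b : B) : (a + a') ⊗ b = a ⊗ b + a' ⊗ b.
Proof. by rewrite /tens (qpi_rel _ (Bilin_Dl a a' b)) raddfD. Qed.

Lemma tensDr (a : A) (b b' : B) : a ⊗ (b + b') = a ⊗ b + a ⊗ b'.
Proof. by rewrite /tens (qpi_rel _ (Bilin_Dr a b b')) raddfD. Qed.

Lemma tensZl c (a : A) (b : B) : (c *: a) ⊗ b = c *: (a ⊗ b).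
Proof. by rewrite /tens (qpi_rel _ (Bilin_Zl c a b)) linearZ. Qed.

Lemma tensZr c (a : A) (b : B) : a ⊗ (c *: b) = c *: (a ⊗ b).
Proof. by rewrite /tens (qpi_rel _ (Bilin_Zr c a b)) linearZ. Qed.

Lemma tensM (a a' : A) (b b' : B) : (a ⊗ b) * (a' ⊗ b') = (a * a') ⊗ (b * b').
Proof. by rewrite /tens -rmorphM -mbasisM. Qed.

Lemma tens11 : (1 : A) ⊗ (1 : B) = 1.
Proof. exact: rmorph1. Qed.

(** Scalars are absorbed into the left factor, so sums of pure tensors already exhaust the tensor
    product and no case for scaling arises. *)
Lemma tens_ind (P : tensor A B -> Prop) :
  (forall a b, P (a ⊗ b)) -> (forall x y, P x -> P y -> P (x + y)) ->
  forall x, P x.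
Proof.
move=> Pt PD x; rewrite -[x]qreprK; elim/ma_ind: (qrepr x) => [|y z Py Pz|c [a b]].
(* Zero is itself a pure tensor, with left factor [0 *: 1]. *)
- by rewrite raddf0 -(scale0r (1 ⊗ 1)) -tensZl.
- by rewrite raddfD; apply: PD.
by rewrite linearZ /= -/(pairing a b) -/(tens a b) -tensZl.
Qed.

Definition tensl (a : A) : tensor A B := a ⊗ 1.

Lemma tensl_zmod : zmod_morphism tensl.
Proof. by move=> x y; rewrite /tensl tensDl -scaleN1r tensZl scaleN1r. Qed.

Lemma tensl_monoid : monoid_morphism tensl.
Proof. by split=> [|x y]; rewrite /tensl ?tens11 // tensM mulr1. Qed.

Lemma tensl_scalable : scalable tensl.
Proof. by move=> c x; rewrite /tensl tensZl. Qed.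

HB.instance Definition _ :=
  GRing.isZmodMorphism.Build A (tensor A B) tensl tensl_zmod.
HB.instance Definition _ :=
  GRing.isMonoidMorphism.Build A (tensor A B) tensl tensl_monoid.
HB.instance Definition _ :=
  GRing.isScalable.Build K A (tensor A B) *:%R tensl tensl_scalable.

Definition tensr (b : B) : tensor A B := 1 ⊗ b.

Lemma tensr_zmod : zmod_morphism tensr.
Proof. by move=> x y; rewrite /tensr tensDr -scaleN1r tensZr scaleN1r. Qed.

Lemma tensr_monoid : monoid_morphism tensr.
Proof. by split=> [|x y]; rewrite /tensr ?tens11 // tensM mulr1. Qed.

Lemma tensr_scalable : scalable tensr.
Proof. by move=> c x; rewrite /tensr tensZr. Qed.

HB.instance Definition _ :=
  GRing.isZmodMorphism.Build B (tensor A B) tensr tensr_zmod.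
HB.instance Definition _ :=
  GRing.isMonoidMorphism.Build B (tensor A B) tensr tensr_monoid.
HB.instance Definition _ :=
  GRing.isScalable.Build K B (tensor A B) *:%R tensr tensr_scalable.

Lemma tensE a b : a ⊗ b = tensl a * tensr b.
Proof. by rewrite tensM mulr1 mul1r. Qed.

Lemma tenslrC a b : GRing.comm (tensl a) (tensr b).
Proof. by rewrite /GRing.comm !tensM !mulr1 !mul1r. Qed.

Section LinearLift.

Variables (C : algType K) (f : {linear A -> C}) (g : {linear B -> C}).

Definition pair_lift : pair_alg A B -> C :=
  mextend (fun p : A * B => f p.1 * g p.2).

HB.instance Definition _ := GRing.Linear.on pair_lift.

Lemma pair_liftE a b : pair_lift (pairing a b) = f a * g b.
Proof. exact: mextendU. Qed.

(** Both sides are linear in [x] and in [y], which may thus be taken to be pairings. A product of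
    pairings is a pairing, so the claim becomes bilinearity of [f a * g b] in [a] and [b]. *)
Lemma pair_lift_bilinearity x y u v : bilinearity u v ->
  pair_lift (x * u * y) = pair_lift (x * v * y).
Proof.
move=> uv.
elim/ma_ind: x => [|x x' IH IH'|c [a0 b0]]; first by rewrite !mul0r.
  by rewrite !mulrDl !linearD /= IH IH'.
rewrite -!scalerAl !linearZ /=; congr (_ *: _).
elim/ma_ind: y => [|y y' IH IH'|d [a1 b1]]; first by rewrite !mulr0.
  by rewrite !mulrDr !linearD /= IH IH'.
rewrite -!scalerAr !linearZ /=; congr (_ *: _).
have pM a b a' b' : pairing a b * pairing a' b' = pairing (a * a') (b * b')
    :> pair_alg A B by rewrite -mbasisM.
rewrite -/(pairing a0 b0) -/(pairing a1 b1).
case: uv => [a a' b|a b b'|k a b|k a b].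
- by rewrite mulrDr mulrDl linearD /= !pM !pair_liftE mulrDr mulrDl linearD mulrDl.
- by rewrite mulrDr mulrDl linearD /= !pM !pair_liftE mulrDr mulrDl linearD mulrDr.
- rewrite -scalerAr -scalerAl linearZ /= !pM !pair_liftE -scalerAr -scalerAl.
  by rewrite linearZ scalerAl.
rewrite -scalerAr -scalerAl linearZ /= !pM !pair_liftE -scalerAr -scalerAl.
by rewrite linearZ scalerAr.
Qed.

Definition tens_lift : tensor A B -> C :=
  qlinlift pair_lift (nz := @bilinearity_proper K A B).

Lemma tens_lift_linear : linear tens_lift.
Proof. exact: qlinlift_linear pair_lift_bilinearity _. Qed.

HB.instance Definition _ :=
  GRing.isLinear.Build K (tensor A B) C *:%R tens_lift tens_lift_linear.

Lemma tens_liftE a b : tens_lift (a ⊗ b) = f a * g b.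
Proof.
by rewrite [LHS](qlinliftE pair_lift_bilinearity); exact: pair_liftE.
Qed.

End LinearLift.

Section AlgebraLift.

Variables (C : algType K) (f : {lrmorphism A -> C}) (g : {lrmorphism B -> C}).

Definition tens_hom (fg : forall a b, GRing.comm (f a) (g b)) :
  tensor A B -> C := tens_lift f g.

Hypothesis fg : forall a b, GRing.comm (f a) (g b).

HB.instance Definition _ := GRing.Linear.on (tens_hom fg).

(** On pure tensors the only obstruction is moving [f a'] past [g b], which [fg] allows. *)
Lemma tens_hom_monoid : monoid_morphism (tens_hom fg).
Proof.
rewrite /tens_hom; split=> [|x y]; first by rewrite -tens11 tens_liftE !rmorph1 mulr1.
elim/tens_ind: x => [a b|x x' IH IH']; last first.
  by rewrite !mulrDl linearD /= IH IH' linearD mulrDl.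
elim/tens_ind: y => [a' b'|y y' IH IH']; last first.
  by rewrite !mulrDr linearD /= IH IH' linearD mulrDr.
by rewrite tensM !tens_liftE !rmorphM -!mulrA; congr (_ * _); rewrite !mulrA fg.
Qed.

HB.instance Definition _ :=
  GRing.isMonoidMorphism.Build (tensor A B) C (tens_hom fg) tens_hom_monoid.

Lemma tens_homE a b : tens_hom fg (a ⊗ b) = f a * g b.
Proof. exact: tens_liftE. Qed.

End AlgebraLift.

End TensorTheory.

(** * The weight grading and twists of homomorphisms by it *)

Section Weights.

Variable n : nat.

Definition delta (i : 'I_n) : {ffun 'I_n -> int} := [ffun j => (j == i)%:Z].

(** The exponent of the Laurent monomial by which eta multiplies the generator. *)
Definition weight (x : qgen n) : {ffun 'I_n -> int} :=
  match x with
  | Ge i | Gf i => delta i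
  | Gw i | Gw' i => delta i + delta i
  | Gwinv i | Gw'inv i => - (delta i + delta i)
  end.

End Weights.

Section Twist.

Variables (K : fieldType) (q : K) (n : nat) (b : 'M[int]_n).
Variables (C : algType K) (theta : {lrmorphism Uqq q b -> C}).
Variable c : {ffun 'I_n -> int} -> C.
Hypotheses (c0 : c 0 = 1) (cD : {morph c : d d' / d + d' >-> d * d'}).
Hypothesis cC : forall d u, GRing.comm (c d) (theta u).

(** Multiplies the image of an element of weight [d] by [c d]. Taking [c d] to be L^d gives eta;
    taking L^-d gives the map that undoes it. *)
Definition twist_free : free_alg K n -> C :=
  mextend (fun s : seq (qgen n) =>
    theta (qpi (mbasis s : free_alg K n)) * c (\sum_(x <- s) weight x)).

HB.instance Definition _ := GRing.Linear.on twist_free.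

Lemma twist_free_monoid : monoid_morphism twist_free.
Proof.
apply: mextend_monoid => [|s t].
  by rewrite big_nil c0 mulr1 mbasis1 !rmorph1.
rewrite mbasisM !rmorphM big_cat /= cD -!mulrA; congr (_ * _).
by rewrite !mulrA cC.
Qed.

HB.instance Definition _ :=
  GRing.isMonoidMorphism.Build (free_alg K n) C twist_free twist_free_monoid.

Lemma twist_free_gen x :
  twist_free (gen K x) = theta (Uqq_gen q b x) * c (weight x).
Proof. by rewrite /twist_free mextendU big_seq1. Qed.

(** The one consequence of having degree [d] that matters here. It is preserved by the operations
    that build the relations, so the free algebra need not be decomposed into graded pieces. *)
Let homogeneous d (x : free_alg K n) :=
  twist_free x = theta (qpi x) * c d.

(* The relations are homogeneous for the grading by [weight]. *)
Lemma twist_free_rel x y : Uqq_rel q b x y -> twist_free x = twist_free y.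
Proof.
have Hg z : homogeneous (weight z) (gen K z) by exact: twist_free_gen.
have He i : homogeneous (delta i) (gen K (Ge i)) := Hg (Ge i).
have Hf i : homogeneous (delta i) (gen K (Gf i)) := Hg (Gf i).
have HM d d' u v : homogeneous d u -> homogeneous d' v ->
    homogeneous (d + d') (u * v).
  rewrite /homogeneous !rmorphM /= cD => -> ->.
  by rewrite -!mulrA; congr (_ * _); rewrite !mulrA cC.
have H0 d : homogeneous d 0 by rewrite /homogeneous !raddf0 mul0r.
have H1 : homogeneous 0 1 by rewrite /homogeneous !rmorph1 c0 mulr1.
have HD d u v : homogeneous d u -> homogeneous d v -> homogeneous d (u + v).
  by rewrite /homogeneous !raddfD mulrDl => /= -> ->.
have HZ d k u : homogeneous d u -> homogeneous d (k *: u).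
  by rewrite /homogeneous !linearZ /= -scalerAl => ->.
have HB d u v : homogeneous d u -> homogeneous d v -> homogeneous d (u - v).
  by move=> Hu Hv; rewrite -scaleN1r; apply/HD/HZ.
have HX d u k : homogeneous d u -> homogeneous (d *+ k) (u ^+ k).
  by move=> Hu; elim: k => // k IH; rewrite exprS mulrS; apply: HM.
have HS d m (F : 'I_m -> free_alg K n) :
    (forall k, homogeneous d (F k)) -> homogeneous d (\sum_k F k).
  by move=> HF; apply: big_ind => // *; apply: HD.
have Hcast d d' u : d = d' -> homogeneous d u -> homogeneous d' u by move=> ->.
(* The two sides of a relation have the same image under [qpi], so it is enough that both are
   homogeneous of a common degree [d]. *)
have key d : Uqq_rel q b x y -> homogeneous d x -> homogeneous d y ->
    twist_free x = twist_free y.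
  by move=> xy -> ->; rewrite (qpi_rel _ xy).
have Hgg z t : homogeneous (weight z + weight t) (gen K z * gen K t).
  exact: HM.
have HggC z t : homogeneous (weight z + weight t) (gen K t * gen K z).
  by rewrite addrC.
have HggV z t : weight z + weight t = 0 -> homogeneous 0 (gen K z * gen K t).
  by move=> <-.
move=> xy; move: (xy).
case: xy key => [i|i|i|i|i j|i j|i j|i j|i j|i j|i j|i|i j ij|i j ij N|i j ij N] key.
- move/key; apply; [by apply: HggV; rewrite /= subrr|exact: H1].
- move/key; apply; [by apply: HggV; rewrite /= addNr|exact: H1].
- move/key; apply; [by apply: HggV; rewrite /= subrr|exact: H1].
- move/key; apply; [by apply: HggV; rewrite /= addNr|exact: H1].
1-3: by move/key; apply; [exact: Hgg|exact: HggC].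
1-4: by move/key; apply; [exact: Hgg|apply: HZ; exact: HggC].
- move/key; apply; first by apply: HB; [exact: Hgg|exact: HggC].
  by apply: HZ; apply: HB; exact: Hg.
- move/key; apply; last exact: H0.
  by apply: HB; [exact: Hgg|exact: HggC].
(* Each term of a Serre sum contains the generator of index [i] exactly [N] times and that of index
   [j] once; zero is homogeneous of every degree. *)
- move/(key (delta i *+ N + delta j)); apply; last exact: H0.
  apply: HS => k; apply/HZ/(Hcast (delta i *+ (N - k) + delta j + delta i *+ k)).
    by rewrite addrAC -mulrnDr subnK // -ltnS.
  exact: (HM _ _ _ _ (HM _ _ _ _ (HX _ _ _ (He i)) (He j)) (HX _ _ _ (He i))).
- move/(key (delta i *+ N + delta j)); apply; last exact: H0.
  apply: HS => k; apply/HZ/(Hcast (delta i *+ k + delta j + delta i *+ (N - k))).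
    by rewrite addrAC -mulrnDr subnKC // -ltnS.
  exact: (HM _ _ _ _ (HM _ _ _ _ (HX _ _ _ (Hf i)) (Hf j)) (HX _ _ _ (Hf i))).
Qed.

Definition twist : Uqq q b -> C := qlift twist_free_rel.

HB.instance Definition _ := GRing.LRMorphism.on twist.

Lemma twistE x : twist (Uqq_gen q b x) = theta (Uqq_gen q b x) * c (weight x).
Proof. by rewrite [LHS](qliftE _ twist_free_rel); exact: twist_free_gen. Qed.

End Twist.

(** * Generators and central elements of U_{q,q^-1}(g) *)

Section UqqTheory.

Variables (K : fieldType) (q : K) (n : nat) (b : 'M[int]_n).

Local Notation U := (Uqq q b).
Local Notation gU := (Uqq_gen q b).

Lemma Uqq_ind (P : U -> Prop) : P 0 -> P 1 ->
  (forall u v, P u -> P v -> P (u + v)) ->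
  (forall k u, P u -> P (k *: u)) ->
  (forall x u, P u -> P (gU x * u)) -> forall u, P u.
Proof.
move=> P0 P1 PD PZ PM u; rewrite -[u]qreprK.
elim/ma_ind: (qrepr u) => [|x y Px Py|k s]; first by rewrite raddf0.
  by rewrite raddfD; apply: PD.
rewrite linearZ; apply: PZ; elim: s => [|x s IH]; first by rewrite mbasis1 rmorph1.
by rewrite -cat1s mbasisM rmorphM; apply: PM.
Qed.

Lemma eq_Uqq_hom (C : algType K) (f g : {lrmorphism U -> C}) :
  (forall x, f (gU x) = g (gU x)) -> f =1 g.
Proof.
move=> fg; elim/Uqq_ind => [||u v IH IH'|k u IH|x u IH].
- by rewrite !raddf0.
- by rewrite !rmorph1.
- by rewrite !raddfD /= IH IH'.
- by rewrite !linearZ /= IH.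
by rewrite !rmorphM /= fg IH.
Qed.

Lemma Uqq_hom_comm (C : algType K) (f : {lrmorphism U -> C}) (a : C) :
  (forall x, GRing.comm a (f (gU x))) -> forall u, GRing.comm a (f u).
Proof.
move=> fa; elim/Uqq_ind => [||u v IH IH'|k u IH|x u IH].
- by rewrite /GRing.comm raddf0 mulr0 mul0r.
- by rewrite /GRing.comm rmorph1 mulr1 mul1r.
- by rewrite /GRing.comm raddfD mulrDr mulrDl IH IH'.
- by rewrite /GRing.comm linearZ -scalerAr -scalerAl IH.
by rewrite /GRing.comm rmorphM mulrA fa -mulrA IH mulrA.
Qed.

Lemma Uqq_genM x y : gU x * gU y = qpi (gen K x * gen K y) :> U.
Proof. exact/esym/rmorphM. Qed.

Lemma Uqq_qpi x y : Uqq_rel q b x y -> qpi x = qpi y :> U.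
Proof. exact: qpi_rel. Qed.

Lemma Uqq_wwinv i : gU (Gw i) * gU (Gwinv i) = 1.
Proof. by rewrite Uqq_genM (Uqq_qpi (Rel_wwinv q b i)) [LHS]rmorph1. Qed.

Lemma Uqq_winvw i : gU (Gwinv i) * gU (Gw i) = 1.
Proof. by rewrite Uqq_genM (Uqq_qpi (Rel_winvw q b i)) [LHS]rmorph1. Qed.

Lemma Uqq_w'w'inv i : gU (Gw' i) * gU (Gw'inv i) = 1.
Proof. by rewrite Uqq_genM (Uqq_qpi (Rel_w'w'inv q b i)) [LHS]rmorph1. Qed.

Lemma Uqq_w'invw' i : gU (Gw'inv i) * gU (Gw' i) = 1.
Proof. by rewrite Uqq_genM (Uqq_qpi (Rel_w'invw' q b i)) [LHS]rmorph1. Qed.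

(** Algebra maps preserve inverses, so the values on the inverse generators are forced. This yields
    uniqueness of eta, whose defining conditions concern these four families only. *)
Lemma eq_Uqq_hom_efww' (C : algType K) (f g : {lrmorphism U -> C}) :
  (forall i, [/\ f (gU (Ge i)) = g (gU (Ge i)), f (gU (Gf i)) = g (gU (Gf i)),
     f (gU (Gw i)) = g (gU (Gw i)) & f (gU (Gw' i)) = g (gU (Gw' i))]) ->
  f =1 g.
Proof.
have inv (u v : U) : u * v = 1 -> v * u = 1 -> f u = g u -> f v = g v.
  move=> uv vu fgu; rewrite -[f v]mulr1 -(rmorph1 g) -uv rmorphM /= -fgu.
  by rewrite mulrA -rmorphM vu rmorph1 mul1r.
move=> fg; apply: eq_Uqq_hom => -[] i; case: (fg i) => // _ _ fgw fgw'.
  exact: inv (Uqq_wwinv i) (Uqq_winvw i) fgw.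
exact: inv (Uqq_w'w'inv i) (Uqq_w'invw' i) fgw'.
Qed.

(** The element z_i, of weight [delta i *+ 4]; eta sends it to 1 ⊗ L_i^4. *)
Definition ww' (i : 'I_n) : U := gU (Gw i) * gU (Gw' i).
Definition ww'inv (i : 'I_n) : U := gU (Gw'inv i) * gU (Gwinv i).

Lemma ww'invK i : ww'inv i * ww' i = 1.
Proof.
by rewrite /ww' /ww'inv -mulrA (mulrA _ _ (gU (Gw' i))) Uqq_winvw mul1r Uqq_w'invw'.
Qed.

Lemma comm_inv (A : nzRingType) (x y z : A) :
  y * z = 1 -> z * y = 1 -> GRing.comm x y -> GRing.comm x z.
Proof.
move=> yz zy xy; rewrite /GRing.comm -[LHS]mul1r -zy -!mulrA (mulrA y) -xy.
by rewrite -!mulrA yz mulr1.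
Qed.

(** Passing e_j or f_j, the two factors w_i and w'_i pick up mutually inverse powers of [q], which
    cancel because [q] is nonzero. Commutation with the inverse generators follows by [comm_inv]. *)
Lemma ww'_central (q0 : q != 0) i u : GRing.comm (ww' i) u.
Proof.
have Cww j : GRing.comm (gU (Gw i)) (gU (Gw j)).
  by rewrite /GRing.comm !Uqq_genM (Uqq_qpi (Rel_ww q b i j)).
have Cww' j k : GRing.comm (gU (Gw j)) (gU (Gw' k)).
  by rewrite /GRing.comm !Uqq_genM (Uqq_qpi (Rel_ww' q b j k)).
have Cw'w' j : GRing.comm (gU (Gw' i)) (gU (Gw' j)).
  by rewrite /GRing.comm !Uqq_genM (Uqq_qpi (Rel_w'w' q b i j)).
have qV k : q ^ k * q ^ (- k) = 1 by rewrite -expfzDr // subrr.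
have Cw j : GRing.comm (ww' i) (gU (Gw j)).
  by apply/commr_sym/commrM; apply: commr_sym => //; apply: commr_sym.
have Cw' j : GRing.comm (ww' i) (gU (Gw' j)).
  by apply/commr_sym/commrM; apply: commr_sym.
have we j : gU (Gw i) * gU (Ge j) = q ^ b i j *: (gU (Ge j) * gU (Gw i)).
  by rewrite Uqq_genM (Uqq_qpi (Rel_we q b i j)) -qpiZ -Uqq_genM.
have wf j : gU (Gw i) * gU (Gf j) = q ^ (- b i j) *: (gU (Gf j) * gU (Gw i)).
  by rewrite Uqq_genM (Uqq_qpi (Rel_wf q b i j)) -qpiZ -Uqq_genM.
have w'e j : gU (Gw' i) * gU (Ge j) = q ^ (- b i j) *: (gU (Ge j) * gU (Gw' i)).
  by rewrite Uqq_genM (Uqq_qpi (Rel_w'e q b i j)) -qpiZ -Uqq_genM.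
have w'f j : gU (Gw' i) * gU (Gf j) = q ^ b i j *: (gU (Gf j) * gU (Gw' i)).
  by rewrite Uqq_genM (Uqq_qpi (Rel_w'f q b i j)) -qpiZ -Uqq_genM.
apply: (Uqq_hom_comm (f := idfun)) => -[] j //=.
- rewrite /GRing.comm -mulrA w'e -scalerAr mulrA we -scalerAl scalerA.
  by rewrite mulrC qV scale1r mulrA.
- rewrite /GRing.comm -mulrA w'f -scalerAr mulrA wf -scalerAl scalerA.
  by rewrite qV scale1r mulrA.
- exact: comm_inv (Uqq_wwinv j) (Uqq_winvw j) _.
exact: comm_inv (Uqq_w'w'inv j) (Uqq_w'invw' j) _.
Qed.

End UqqTheory.

(** * Integer powers, and fourth roots where they exist *)

Section QuarterPower.

Variables (A : nzRingType) (z zinv : A).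
Hypothesis zinvK : zinv * z = 1.

Definition int_pow (m : int) : A :=
  match m with Posz k => z ^+ k | Negz k => zinv ^+ k.+1 end.

Lemma int_powS m : int_pow (m + 1) = int_pow m * z.
Proof.
case: m => [k|[|k]]; first by rewrite -PoszD addn1 /= exprSr.
  by rewrite /= expr1 zinvK.
have -> : Negz k.+1 + 1 = Negz k.
  by rewrite !NegzE -[k.+2]addn1 PoszD opprD addrNK.
by rewrite /= [in RHS]exprSr -mulrA zinvK mulr1.
Qed.

(** The one-variable projection of K[L, L^-1] onto the powers of z = L^4, evaluated at L^m. *)
Definition quarter_pow (m : int) : A :=
  if (4 %| m)%Z then int_pow (m %/ 4)%Z else 0.

Lemma quarter_powD4 m : quarter_pow (m + 4) = quarter_pow m * z.
Proof.
rewrite /quarter_pow rpredDr //; case: ifP => _; last by rewrite mul0r.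
by rewrite addrC -[X in (X + m)%R]mul1r divzMDl // addrC int_powS.
Qed.

End QuarterPower.

(** The product is noncommutative; centrality of [z] lets its copies move to the right end. *)
Lemma prod_mul_central (A : nzRingType) (I : eqType) (r : seq I) (i : I)
  (F : I -> A) (z : A) : (forall a, GRing.comm z a) ->
  \prod_(j <- r) (F j * z ^+ (j == i)) =
  (\prod_(j <- r) F j) * z ^+ (count_mem i r).
Proof.
move=> zC; elim: r => [|j r IH]; first by rewrite !big_nil mulr1.
rewrite !big_cons /= IH exprD -!mulrA; congr (_ * _).
by rewrite mulrA (commr_sym (commrX _ (commr_sym (zC _)))) -mulrA.
Qed.

Lemma laurentC (K : comNzRingType) n (x y : laurent K n) : x * y = y * x.
Proof.
elim/ma_ind: x => [|x x' IH IH'|c a]; first by rewrite mul0r mulr0.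
  by rewrite mulrDl mulrDr IH IH'.
rewrite -scalerAl -scalerAr; congr (_ *: _).
elim/ma_ind: y => [|y y' IH IH'|d a']; first by rewrite mul0r mulr0.
  by rewrite mulrDl mulrDr IH IH'.
rewrite -scalerAl -scalerAr -!mbasisM; congr (_ *: mbasis _); exact: addrC.
Qed.

(** * Adjoining fourth roots of the central elements *)

Section Adjoin.

Variables (K : fieldType) (q : K) (n : nat) (b : 'M[int]_n).
Hypothesis q_neq0 : q != 0.

Local Notation U := (Uqq q b).
Local Notation gU := (Uqq_gen q b).
Local Notation Lau := (laurent K n).
Local Notation W := (tensor U Lau).
Local Notation mon d := (mbasis d : Lau).

(* [z^(d/4)], or 0 unless 4 divides every entry of [d] *)
Definition root_monomial (d : {ffun 'I_n -> int}) : U :=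
  \prod_i quarter_pow (ww' q b i) (ww'inv q b i) (d i).

Lemma root_monomial0 : root_monomial 0 = 1.
Proof. by apply: big1 => i _; rewrite ffunE. Qed.

Lemma root_monomialD4 d i :
  root_monomial (d + delta i *+ 4) = root_monomial d * ww' q b i.
Proof.
transitivity (\prod_j (quarter_pow (ww' q b j) (ww'inv q b j) (d j) *
                       ww' q b i ^+ (j == i))).
  apply: eq_bigr => j _; rewrite !(ffunE, ffunMnE); case: eqVneq => [->|_].
    by rewrite quarter_powD4 ?ww'invK.
  by rewrite [X in quarter_pow _ _ X]addr0 mulr1.
rewrite prod_mul_central; last exact: ww'_central.
(* The index [i] occurs exactly once in the enumeration, so a single factor z_i comes out. *)
by rewrite count_uniq_mem ?index_enum_uniq // mem_index_enum.
Qed.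

(** Linear but not multiplicative: L_i goes to 0 while L_i^4 goes to z_i. It does turn
    multiplication by L_i^4 into multiplication by z_i. *)
Definition quartic_proj : Lau -> U := mextend root_monomial.

HB.instance Definition _ := GRing.Linear.on quartic_proj.

Lemma quartic_projM x i :
  quartic_proj (x * mon (delta i *+ 4)) = quartic_proj x * ww' q b i.
Proof.
elim/ma_ind: x => [|x y IH IH'|c d]; first by rewrite mul0r !raddf0 mul0r.
  by rewrite mulrDl !raddfD /= IH IH' mulrDl.
rewrite -scalerAl !linearZ /= -scalerAl -mbasisM; congr (_ *: _).
by rewrite /quartic_proj !mextendU root_monomialD4.
Qed.

Inductive root_rel : W -> W -> Prop :=
| Rel_root i : root_rel (ww' q b i ⊗ 1) (1 ⊗ mon (delta i *+ 4)).

Definition root_proj : W -> U := tens_lift idfun quartic_proj.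

HB.instance Definition _ := GRing.Linear.on root_proj.

Lemma root_projE u x : root_proj (u ⊗ x) = u * quartic_proj x.
Proof. exact: tens_liftE. Qed.

(** For x = u ⊗ l and y = v ⊗ l', write p for the projection of l l'. The two sides are u z_i v p
    and u v p z_i, which agree because z_i is central. *)
Lemma root_proj_rel x y s t : root_rel s t ->
  root_proj (x * s * y) = root_proj (x * t * y).
Proof.
case=> i.
elim/tens_ind: x => [u l|x x' IH IH']; last by rewrite !mulrDl !raddfD /= IH IH'.
elim/tens_ind: y => [v l'|y y' IH IH']; last by rewrite !mulrDr !raddfD /= IH IH'.
rewrite !tensM !root_projE !mulr1 -(mulrA l) (laurentC (mon _)) (mulrA l).
rewrite quartic_projM; have zC := @ww'_central _ q n b q_neq0 i.
by move: (ww' q b i) zC => z zC; rewrite -!mulrA zC -mulrA.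
Qed.

Lemma root_proj1 u : root_proj (u ⊗ 1) = u.
Proof.
by rewrite root_projE -mbasis1 /quartic_proj mextendU root_monomial0 mulr1.
Qed.

(** [root_proj] kills the ideal but sends 1 to 1. *)
Lemma root_rel_proper : ~ in_ideal root_rel 1.
Proof.
move=> I1; have /eqP : root_proj (1 ⊗ 1) = 0.
  by rewrite tens11; exact: (linear_ideal_ker root_proj_rel I1).
by rewrite root_proj1 oner_eq0.
Qed.

Definition adjoin_roots : Type := alg_quot root_rel_proper.

HB.instance Definition _ := GRing.Algebra.on adjoin_roots.

Definition adjoin_in : U -> adjoin_roots := qpi \o @tensl K U Lau.

HB.instance Definition _ := GRing.LRMorphism.on adjoin_in.

(** [root_proj] descends to the quotient, where it is a linear left inverse of [adjoin_in]. *)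
Lemma adjoin_in_inj : injective adjoin_in.
Proof.
move=> u v uv; rewrite -[u]root_proj1 -[v]root_proj1.
have E := qlinliftE root_proj_rel root_rel_proper.
by rewrite -E -[RHS]E; congr qlinlift.
Qed.

Definition adjoin_root : Lau -> adjoin_roots := qpi \o @tensr K U Lau.

HB.instance Definition _ := GRing.LRMorphism.on adjoin_root.

Lemma adjoin_in_rootC u x : GRing.comm (adjoin_in u) (adjoin_root x).
Proof.
have qpiM s t : qpi s * qpi t = qpi (s * t) :> adjoin_roots.
  exact/esym/rmorphM.
by rewrite /GRing.comm [LHS]qpiM tenslrC [RHS]qpiM.
Qed.

Lemma adjoin_root4 i :
  adjoin_in (ww' q b i) = adjoin_root (mon (delta i *+ 4)).
Proof. exact: qpi_rel (Rel_root i). Qed.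

(** * The map from U_q(g) to the extension by roots *)

Definition monV (d : {ffun 'I_n -> int}) : adjoin_roots := adjoin_root (mon (- d)).

Lemma monV0 : monV 0 = 1.
Proof. by rewrite /monV oppr0 mbasis1 rmorph1. Qed.

Lemma monVD : {morph monV : d d' / d + d' >-> d * d'}.
Proof. by move=> d d'; rewrite /monV opprD mbasisM rmorphM. Qed.

Lemma monVC d u : GRing.comm (monV d) (adjoin_in u).
Proof. exact/commr_sym/adjoin_in_rootC. Qed.

(* The twist by [L^-d], which makes [w i] and [w' i] mutually inverse. *)
Definition untwist : U -> adjoin_roots := twist monV0 monVD monVC.

HB.instance Definition _ := GRing.LRMorphism.on untwist.

(** Here w'_i = w_i^-1 z_i and z_i has become L_i^4, so w'_i L_i^-2 = w_i^-1 L_i^2. The right side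
    is the twisted image of w_i^-1, whose weight is opposite to that of w_i. *)
Lemma untwist_rel u v : Uq_rel u v -> untwist u = untwist v.
Proof.
case=> i; rewrite /untwist [LHS]twistE [RHS]twistE /weight /monV.
set d := delta i + delta i.
have d4 : delta i *+ 4 - d = d.
  by apply/eqP; rewrite subr_eq /d -!mulr2n -mulrnA.
have -> : gU (Gw' i) = gU (Gwinv i) * ww' q b i.
  by rewrite /ww' mulrA Uqq_winvw mul1r.
rewrite rmorphM -mulrA; congr (_ * _); rewrite /= adjoin_root4 -rmorphM -mbasisM.
by congr (adjoin_root (mon _)); rewrite opprK; exact: d4.
Qed.

Definition descend : Uq q b -> adjoin_roots := qlift untwist_rel.

HB.instance Definition _ := GRing.LRMorphism.on descend.

Lemma descendE x :
  descend (Uq_gen q b x) = adjoin_in (gU x) * monV (weight x).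
Proof. by rewrite [LHS](qliftE _ untwist_rel) [LHS]twistE. Qed.

(** Values of [descend] are values of [untwist], so generators suffice. Each is sent to an element
    of U times a Laurent monomial, and both factors commute with the roots. *)
Lemma descend_rootC u x : GRing.comm (descend u) (adjoin_root x).
Proof.
rewrite -[u]qreprK /descend [qlift _ _](qliftE _ untwist_rel).
apply/commr_sym/(Uqq_hom_comm (f := untwist)) => y.
rewrite [X in GRing.comm _ X]twistE; apply: commrM.
  exact/commr_sym/adjoin_in_rootC.
by rewrite /GRing.comm -!rmorphM laurentC.
Qed.

(** * The homomorphism eta and its injectivity *)

Definition eta_mon (d : {ffun 'I_n -> int}) : tensor (Uq q b) Lau :=
  tensr (Uq q b) (mon d).

Definition to_Uq : U -> tensor (Uq q b) Lau := tensl Lau \o (qpi : U -> Uq q b).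

HB.instance Definition _ := GRing.LRMorphism.on to_Uq.

Lemma eta_mon0 : eta_mon 0 = 1.
Proof. by rewrite /eta_mon mbasis1 rmorph1. Qed.

Lemma eta_monD : {morph eta_mon : d d' / d + d' >-> d * d'}.
Proof. by move=> d d'; rewrite /eta_mon mbasisM rmorphM. Qed.

Lemma eta_monC d u : GRing.comm (eta_mon d) (to_Uq u).
Proof. exact/commr_sym/tenslrC. Qed.

Definition eta : U -> tensor (Uq q b) Lau := twist eta_mon0 eta_monD eta_monC.

HB.instance Definition _ := GRing.LRMorphism.on eta.

Lemma etaE x : eta (gU x) = Uq_gen q b x ⊗ mon (weight x).
Proof. by rewrite /eta twistE tensE. Qed.

Definition eta_retract : tensor (Uq q b) Lau -> adjoin_roots :=
  tens_hom descend_rootC.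

HB.instance Definition _ := GRing.LRMorphism.on eta_retract.

(** Both sides are algebra maps in [u], so generators suffice: for a generator of weight d, eta
    contributes L^d and [descend] contributes L^-d. *)
Lemma eta_retractK u : eta_retract (eta u) = adjoin_in u.
Proof.
apply: (eq_Uqq_hom (f := eta_retract \o eta)) => x /=.
transitivity (descend (Uq_gen q b x) * adjoin_root (mon (weight x))).
  by rewrite etaE; exact: tens_homE.
rewrite descendE -mulrA -rmorphM -mbasisM.
by rewrite [X in mbasis X]addNr mbasis1 rmorph1 mulr1.
Qed.

Lemma eta_inj : injective eta.
Proof. by move=> u v uv; apply: adjoin_in_inj; rewrite -!eta_retractK uv. Qed.

Lemma eta_generators : eta_on_generators eta.
Proof.
move=> i L; rewrite !etaE /= expr2 -mbasisM; split=> //.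
(* Only the image of w'_i is left; in U_q(g) it coincides with that of w_i^-1. *)
by rewrite /Uq_gen (qpi_rel _ (Rel_w'_winv q b i)).
Qed.

End Adjoin.

(** * Existence, injectivity and uniqueness of eta *)

Theorem proposition5p4 (K : closedFieldType) (q : K)
    (q_transcendental : transcendental q)
    (F : closedFieldType) (F_char0 : [pchar F] =i pred0)
    (g : lieAlgType F) (g_simple : lie_simple g)
    (h : {vspace g}) (h_cartan : cartan_subalgebra h)
    (n : nat) (alpha : 'I_n -> 'Hom(subvs_of h, F^o))
    (alpha_simple : simple_roots alpha)
    (form : 'Hom(subvs_of h, F^o) -> 'Hom(subvs_of h, F^o) -> F)
    (form_normalized : normalized_form form)
    (b : 'M[int]_n)
    (b_form : forall i j, form (alpha i) (alpha j) = (b i j)%:~R) :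
  exists eta : {lrmorphism Uqq q b -> tensor (Uq q b) (laurent K n)},
    [/\ injective eta,
        eta_on_generators eta
      & forall eta' : {lrmorphism Uqq q b -> tensor (Uq q b) (laurent K n)},
          injective eta' -> eta_on_generators eta' -> eta' =1 eta].
Proof.
(* Transcendence is applied to the polynomial X, whose only root is 0. Nonvanishing of [q] is what
   makes the z_i central. *)
have q_neq0 : q != 0.
  have := q_transcendental 'X; rewrite map_polyX => /(_ (negbT (polyX_eq0 _))).
  by rewrite rootX.
exists (@eta K q n b); split=> [||eta' _ eta'_gen]; first exact: eta_inj.
  exact: eta_generators.
apply: eq_Uqq_hom_efww' => i.
have [e1 f1 w1 w1'] := eta'_gen i.
have [e2 f2 w2 w2'] := @eta_generators K q n b i.
by rewrite e1 f1 w1 w1'; split.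
Qed.
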